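(* For any $A,B\subseteq\mathbb N$, the following are equivalent. (1) $A\leq_{\mathrm{fe}}B$. (2) The family $\{B-a:a\in A\}$ has the finite intersection property. (3) There exists an ultrafilter $\mathcal V$ on $\mathbb N$ such that $A$ is a subset of the leftward $\mathcal V$-shift of $B$, namely $B-\mathcal V=\{x\in\mathbb N:B-x\in\mathcal V\}$. (4) There exists an ultrafilter $\mathcal V$ on $\mathbb N$ such that $A=B'-\mathcal V$ for some subset $B'$ of $B$. (5) The basic open sets $\overline A$ and $\overline B$ in the Stone-Čech compactification $\beta\mathbb N$ satisfy $\overline A+\mathcal V\subseteq\overline B$ for some ultrafilter $\mathcal V\in\beta\mathbb N$. (6) Some superset of $A$ (in $\mathcal P(\mathbb N)$) is in the topological closure, in the power set $\mathcal P(\mathbb N)$, of the set of leftward shifts $\{B-k:k\in\mathbb N\}$ of $B$. (7) There is a subset $B'$ of $B$ such that $A$ is in the topological closure, in $\mathcal P(\mathbb N)$, of the set of leftward shifts $\{B'-k:k\in\mathbb N\}$ of $B'$. (8) There exists $\mu\in{}^*\mathbb N$ such that $A\subseteq B_\mu$. (9) $A'=B_\mu$ for some superset $A'$ of $A$ and some $\mu\in{}^*\mathbb N$. (10) $A=B'_\mu$ for some subset $B'$ of $B$ and some $\mu\in{}^*\mathbb N$.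
   Context: $\mathbb N$ contains $0$. For $A\subseteq\mathbb N$ and $k\in\mathbb N$: $A+k=\{a+k:a\in A\}$ and $A-k=\{x\in\mathbb N:x+k\in A\}$. For $A,B\subseteq\mathbb N$, $A\leq_{\mathrm{fe}}B$ ($A$ is finitely embeddable in $B$) means that for each finite $F\subseteq A$ there is $k\in\mathbb N$ with $F+k\subseteq B$. For $X\subseteq\mathbb N$ and an ultrafilter $\mathcal V$ on $\mathbb N$, the leftward $\mathcal V$-shift of $X$ is $X-\mathcal V=\{x\in\mathbb N:X-x\in\mathcal V\}$. $\beta\mathbb N$ is identified with the set of all ultrafilters on $\mathbb N$ (principal ones included), with basic open sets $\overline A=\{\mathcal U\in\beta\mathbb N:A\in\mathcal U\}$. Addition on $\beta\mathbb N$ is $\mathcal U+\mathcal V=\{X\subseteq\mathbb N:\{k\in\mathbb N:X-k\in\mathcal V\}\in\mathcal U\}$, and $\overline A+\mathcal V=\{\mathcal U+\mathcal V:\mathcal U\in\overline A\}$. The power set $\mathcal P(\mathbb N)$ carries the product topology of $\{0,1\}^{\mathbb N}$ ($\{0,1\}$ discrete) via characteristic functions. Nonstandard setting: one works in a fixed framework of nonstandard analysis, in which each standard set $X$ has a hyper-extension ${}^*X$, the transfer principle holds, and the $\mathfrak c^+$-enlarging property holds: whenever a family $\mathfrak X$ of sets, of cardinality at most the continuum $\mathfrak c$, has the finite intersection property, the intersection $\bigcap_{X\in\mathfrak X}{}^*X$ is nonempty. ${}^*\mathbb N\supseteq\mathbb N$ is the set of hypernatural numbers. For $X\subseteq\mathbb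 N$ and $\mu\in{}^*\mathbb N$, $X_\mu=\{n\in\mathbb N:\mu+n\in{}^*X\}$. *)

(* Defs.v *)
From HB Require Import structures.
From mathcomp Require Import all_boot all_order.
From mathcomp Require Import boolp classical_sets functions cardinality filter.
From mathcomp Require Import topology cantor.

Set Implicit Arguments.
Unset Strict Implicit.
Unset Printing Implicit Defensive.

Local Open Scope classical_set_scope.

Definition rightshift (A : set nat) (k : nat) : set nat :=
  [set (a + k)%N | a in A].

Definition leftshift (A : set nat) (k : nat) : set nat := [set x | A (x + k)%N].

Definition finitely_embeddable (A B : set nat) : Prop :=
  forall F : set nat, finite_set F -> F `<=` A ->
    exists k : nat, rightshift F k `<=` B.

Definition fip {T : Type} (X : set (set T)) : Prop := finI X id.

Definition ultra_leftshift (X : set nat) (V : set_system nat) : set nat :=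
  [set x | V (leftshift X x)].

Record betaN := BetaN {
  ultra : set_system nat;
  ultra_ultrafilter : UltraFilter ultra }.

Definition basic_open (A : set nat) : set betaN := [set U | ultra U A].

HB.instance Definition _ := gen_eqMixin betaN.
HB.instance Definition _ := gen_choiceMixin betaN.
HB.instance Definition _ :=
  isSubBaseTopological.Build betaN [set: set nat] basic_open.

Lemma betaN_add_subproof (U V : betaN) :
  UltraFilter [set X | ultra U [set k | ultra V (leftshift X k)]].
Proof.
have FU := ultra_ultrafilter U; have FV := ultra_ultrafilter V.
set W := [set X | _].
have PW : ProperFilter W.
  apply: Build_ProperFilter_ex.
    move=> X WX; have [k Vk] := filter_ex (F := ultra U) WX.
    by have [x ?] := filter_ex (F := ultra V) Vk; exists (x + k)%N.
  split.
  - by apply: (@filterE _ (ultra U)) => k; apply: (@filterE _ (ultra V)).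
  - move=> X Y WX WY; apply: (@filterS2 _ (ultra U) _ _ _ _ _ WX WY) => k.
    exact: filterI.
  - move=> X Y sXY; apply: (@filterS _ (ultra U)) => k.
    by apply: (@filterS _ (ultra V)) => x; apply: sXY.
split=> // G PG sWG; apply/seteqP; split=> // X GX.
have [WX|WnX] : W X \/ W (~` X).
  have [h|h] := in_ultra_setVsetC [set k | ultra V (leftshift X k)] FU.
    by left.
  right; apply: filterS h => k /= nVX.
  by have [|] := in_ultra_setVsetC (leftshift X k) FV.
- by [].
- by have [x []] := filter_ex (filterI GX (sWG _ WnX)).
Qed.

Definition betaN_add (U V : betaN) : betaN := BetaN (betaN_add_subproof U V).

Definition charfun (A : set nat) : cantor_space := fun n => `[< A n >].

(* Standard sets are types, and [tup F [:: X1; ...; Xn]] is the product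
   [F X1 * ... * F Xn]; with [F := idfun] these are standard tuples, with [F]
   the hyper-extension they are tuples of nonstandard elements. *)
Fixpoint tup (F : Type -> Type) (s : seq Type) : Type :=
  if s is X :: s' then (F X * tup F s')%type else unit.

Fixpoint tup_map (F F' : Type -> Type) (h : forall X, F X -> F' X) s :
    tup F s -> tup F' s :=
  match s return tup F s -> tup F' s with
  | [::] => fun _ => tt
  | X :: s' => fun t => (h X t.1, tup_map h t.2)
  end.

Inductive var : seq Type -> Type -> Type :=
| var_here G X : var (X :: G) X
| var_next G X Y : var G X -> var (Y :: G) X.

Fixpoint var_eval (F : Type -> Type) G X (x : var G X) : tup F G -> F X :=
  match x in var G X return tup F G -> F X with
  | var_here _ _ => fun v => v.1
  | var_next _ _ _ y => fun v => var_eval y v.2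
  end.

(* First-order formulas with free variables of sorts [G], in the language with
   one sort for each standard set and one symbol for each standard relation.
   Quantifiers are bounded: each one ranges over a sort. As power sets are
   sorts and membership is a standard relation, this is the language of
   bounded quantifier formulas about standard sets. *)
Inductive formula : seq Type -> Type :=
| fRel G s : set (tup idfun s) -> tup (var G) s -> formula G
| fEq G X : var G X -> var G X -> formula G
| fNot G : formula G -> formula G
| fAnd G : formula G -> formula G -> formula G
| fAll G X : formula (X :: G) -> formula G.

Fixpoint sat (F : Type -> Type)
    (I : forall s, set (tup idfun s) -> set (tup F s))
    G (phi : formula G) : tup F G -> Prop :=
  match phi in formula G return tup F G -> Prop with
  | fRel _ s R xs => fun v => I s R (tup_map (fun _ x => var_eval x v) xs)
  | fEq _ _ x y => fun v => var_eval x v = var_eval y v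
  | fNot _ phi => fun v => ~ sat I phi v
  | fAnd _ phi psi => fun v => sat I phi v /\ sat I psi v
  | fAll _ X phi => fun v => forall x : F X, sat I phi (x, v)
  end.

Record framework := Framework {
  star : Type -> Type;
  std : forall X, X -> star X;
  star_rel : forall s, set (tup idfun s) -> set (tup star s);
  transfer : forall G (phi : formula G) (v : tup idfun G),
    sat (fun _ R => R) phi v <-> sat star_rel phi (tup_map std v) }.

Definition star_set (N : framework) X (A : set X) : set (star N X) :=
  [set x | star_rel (f := N) (s := [:: X]) [set t | A t.1] (x, tt)].
Arguments star_set N {X} A.

(* The finite intersection property includes the empty subfamily, so that [X]
   is nonempty. The continuum is the cardinality of [set nat]. *)
Definition continuum_enlarging (N : framework) : Prop :=
  forall (X : Type) (Y : set (set X)),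
    (Y #<= [set: set nat])%card -> fip Y ->
    \bigcap_(A in Y) star_set N A !=set0.

Section HyperFunction.
Variables (N : framework) (X Y Z : Type) (f : X -> Y -> Z).

Definition star_graph (x : star N X) (y : star N Y) (z : star N Z) : Prop :=
  star_rel (f := N) (s := [:: X; Y; Z])
    [set t | f t.1 t.2.1 = t.2.2.1] (x, (y, (z, tt))).

Lemma star_graph_ex x y : exists z, star_graph x y z.
Proof.
pose phi : formula [::] := fAll (X := X) (fAll (X := Y) (fNot (fAll (X := Z)
  (fNot (@fRel [:: Z; Y; X] [:: X; Y; Z] [set t | f t.1 t.2.1 = t.2.2.1]
    (var_next _ (var_next _ (var_here _ _)),
     (var_next _ (var_here _ _), (var_here _ _, tt)))))))).
have := (transfer N phi tt).1; rewrite /= => /(_ _ x y) h.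
apply: contrapT => /forallNP nz; apply: h => // a b /(_ (f a b)).
exact.
Qed.

Lemma star_graph_uniq x y z z' :
  star_graph x y z -> star_graph x y z' -> z = z'.
Proof.
pose R : set (tup idfun [:: X; Y; Z]) := [set t | f t.1 t.2.1 = t.2.2.1].
pose G : seq Type := [:: Z; Z; Y; X].
pose vX : var G X := var_next _ (var_next _ (var_next _ (var_here _ _))).
pose vY : var G Y := var_next _ (var_next _ (var_here _ _)).
pose vZ : var G Z := var_next _ (var_here _ _).
pose vZ' : var G Z := var_here _ _.
pose phi : formula [::] :=
  fAll (X := X) (fAll (X := Y) (fAll (X := Z) (fAll (X := Z) (fNot
    (fAnd (fAnd (@fRel G [:: X; Y; Z] R (vX, (vY, (vZ, tt))))
                    (@fRel G [:: X; Y; Z] R (vX, (vY, (vZ', tt)))))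
              (fNot (fEq vZ vZ'))))))).
have := (transfer N phi tt).1; rewrite /= => /(_ _ x y z z') h gz gz'.
apply: contrapT => nzz'; apply: h => // a b c c' [[e e']]; apply.
exact: etrans (esym e) e'.
Qed.

Definition star_fun (x : star N X) (y : star N Y) : star N Z :=
  projT1 (cid (star_graph_ex x y)).

End HyperFunction.

(* The natural number [n] is identified with [std N n]. *)
Definition hyper_leftshift (N : framework) (A : set nat) (mu : star N nat) :
    set nat :=
  [set n | star_set N A (star_fun addn mu (std N n))].

(* Main.v *)
Require Import Defs.
From mathcomp Require Import all_boot all_order finmap.
From mathcomp Require Import boolp classical_sets functions cardinality filter.
From mathcomp Require Import topology cantor.

Local Open Scope classical_set_scope.

(* (1) says that the sets K n of all k with (A `&` [0, n]) + k `<=` B, which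
   decrease with n, are nonempty. If they are all infinite, pick a sparse
   sequence k_n in K n: the union B' of the sets (A `&` [0, n]) + k_n has
   B' - V = A for every ultrafilter V containing all the tails of k_n.
   Otherwise some k lies in all of them, and V is principal. This is the
   implication from (1) to (4), the only combinatorial one. The topological
   conditions reduce to ultrafilters because X - V is the limit of the shifts
   X - k along V. The nonstandard ones do because the sets X with mu in *X form
   an ultrafilter, by which the shift of X is X_mu, and every ultrafilter on nat
   is of this form by the enlarging property. *)

Lemma filter_forall_finite {I T : Type} (F : set_system T) (D : set I)
    (P : I -> set T) :
  Filter F -> finite_set D -> (forall i, D i -> F (P i)) ->
  F [set x | forall i, D i -> P i x].
Proof.
move=> FF; elim/Pchoice: I => I in D P *; move=> finD FP.
have := @filter_bigI _ _ (fset_set D) P F FF; rewrite fset_setK //; apply.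
by move=> i; rewrite in_fset_set // inE => /FP.
Qed.

Lemma in_leftshift (A : set nat) (k x : nat) : leftshift A k x = A (x + k)%N.
Proof. by []. Qed.

(** * Finite embeddability, finite intersections and ultrafilter shifts *)

Lemma finitely_embeddableP (A B : set nat) :
  finitely_embeddable A B <->
  forall F, finite_set F -> F `<=` A ->
    exists k, forall a, F a -> B (a + k)%N.
Proof.
split=> AB F finF FA; have [k Bk] := AB F finF FA; exists k.
  by move=> a Fa; apply: Bk; exists a.
by move=> _ [a Fa <-]; exact: Bk.
Qed.

Lemma ultra_leftshiftS (A B : set nat) (V : set_system nat) :
  Filter V -> A `<=` B -> ultra_leftshift A V `<=` ultra_leftshift B V.
Proof. by move=> FV AB x; apply: filterS => k; exact: AB. Qed.

Lemma ultra_leftshift_finitely_embeddable (A B : set nat) (V : set_system nat) :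
  ProperFilter V -> A `<=` ultra_leftshift B V -> finitely_embeddable A B.
Proof.
move=> PV AB; apply/finitely_embeddableP => F finF FA.
have /filter_ex[k Bk] : V [set k | forall a, F a -> leftshift B a k].
  by apply: filter_forall_finite => // a /FA/AB.
by exists k => a Fa; rewrite addnC; exact: Bk.
Qed.

Lemma fip_finitely_embeddable (A B : set nat) :
  fip [set leftshift B a | a in A] <-> finitely_embeddable A B.
Proof.
split=> [fipB|/finitely_embeddableP AB D DB].
  apply/finitely_embeddableP => F finF FA.
  have finD : finite_set [set leftshift B a | a in F] by exact: finite_image.
  have [|k] := fipB (fset_set [set leftshift B a | a in F]) _.
    move=> X; rewrite in_fset_set // !inE => -[a Fa <-].
    by exists a => //; exact: FA.
  rewrite fset_setK // => Dk; exists k => a Fa; rewrite addnC.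
  by apply: (Dk (leftshift B a)); exists a.
(* The subfamily [D] consists of sets, so [f] picks for each a point of [A] that indexes it; outside
   [D] the value 0 is arbitrary. *)
have /choice[f fP] : forall X : set nat, exists a,
    X \in D -> A a /\ leftshift B a = X.
  move=> X; have [/DB|] := boolP (X \in D); last by exists 0.
  by rewrite inE => -[a Aa BX]; exists a.
have [||k Bk] := AB [set f X | X in [set` D]].
- by apply: finite_image; exact: finite_fset.
- by move=> _ [X /= /fP[Af _] <-].
exists k => X /= XD; have [_ <-] := fP X XD.
by rewrite in_leftshift addnC; apply: Bk; exists X.
Qed.

(** * Closures of sets of shifts in the Cantor space *)

Lemma closure_finitely_embeddable (A B : set nat) :
  closure [set charfun (leftshift B k) | k in [set: nat]] (charfun A) ->
  finitely_embeddable A B.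
Proof.
move=> clA; apply/finitely_embeddableP => F finF FA.
(* Being true on the finite set [F] constrains finitely many coordinates, hence is an open
   condition. *)
have /clA[_ [[k _ <-] Fk]] : nbhs (charfun A)
    [set f : cantor_space | forall a, F a -> f a = true].
  apply: filter_forall_finite => // a /FA Aa.
  have := @proj_continuous nat (fun=> bool) a (charfun A) [set true].
  apply; rewrite /charfun /mathcomp_extra.proj/= asboolT//.
by exists k => a Fa; apply/asboolP; exact: (Fk a).
Qed.

Lemma closure_ultra_leftshift (B : set nat) (V : set_system nat) :
  UltraFilter V ->
  closure [set charfun (leftshift B k) | k in [set: nat]]
    (charfun (ultra_leftshift B V)).
Proof.
move=> UV; pose g k : cantor_space := charfun (leftshift B k).
have gV : g @ V --> (charfun (ultra_leftshift B V) : cantor_space).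
  (* Convergence is coordinatewise, and each factor is discrete: it suffices that [V]-almost every
     [k] has the limit value at [n]. *)
  apply/cvg_sup => n U [W [[Z oZ <-] /= ZV] WU].
  apply: (filterS WU); rewrite nbhs_simpl /=.
  suff: V [set k | g k n = charfun (ultra_leftshift B V) n].
    by apply: filterS => k /= gkn; rewrite /= gkn.
  have [VB|VnB] := in_ultra_setVsetC (leftshift B n) UV.
    have -> : charfun (ultra_leftshift B V) n = true by exact/asboolP.
    by apply: filterS VB => k; rewrite in_leftshift addnC => Bk; exact/asboolP.
  have -> : charfun (ultra_leftshift B V) n = false.
    apply/asboolPn => VB; have [k []] := filter_ex (filterI VB VnB); exact.
  apply: filterS VnB => k; rewrite /= in_leftshift addnC => nBk; exact/asboolPn.
rewrite closureEcvg; exists (g @ V); first exact: fmap_proper_filter.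
split=> // U gU.
by apply: (@filterE _ V) => k; apply: gU; exists k.
Qed.

(** * Realizing [A] exactly as an ultrafilter shift of a subset of [B] *)

Section ShiftEquality.
Variables A B : set nat.

(** [emb n] is the set K n of the overview. *)
Let emb n k := forall a, A a -> (a <= n)%N -> B (a + k)%N.

Let sparse_shift : (forall n m, exists2 k, (m <= k)%N & emb n k) ->
  exists V : set_system nat, UltraFilter V /\
    exists B', B' `<=` B /\ A = ultra_leftshift B' V.
Proof.
move=> embB.
have [f fm femb] : exists2 f : nat -> nat -> nat,
    forall n m, (m <= f n m)%N & forall n m, emb n (f n m).
  have /choice[f fP] : forall p, exists k, (p.2 <= k)%N /\ emb p.1 k.
    by move=> [n m]; have [k ? ?] := embB n m; exists k.
  by exists (fun n m => f (n, m)) => n m; have [] := fP (n, m).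
(* As n = m + 1, the lower bound [k m + n] puts [k n] strictly beyond the window [k m, k m + m] that
   holds the m-th block of [B']. *)
pose k := fix k n := if n is m.+1 then f n (k m + n)%N else f 0 0.
have kemb n : emb n (k n) by case: n => *; exact: femb.
have kS n : (k n + n < k n.+1)%N.
  by apply: leq_trans (fm _ _); rewrite addnS.
have k_lt m n : (m < n)%N -> (k m + m < k n)%N.
  elim: n => // n IH; rewrite ltnS leq_eqVlt => /predU1P[->//|/IH kmn].
  apply: leq_trans kmn _; apply: leq_trans (ltnW (kS n)); exact: leq_addr.
pose B' := [set x | exists n a, [/\ A a, (a <= n)%N & x = (a + k n)%N]].
(* The windows are disjoint, so only the n-th block meets [k n, k n + n]: earlier blocks end before
   it, later ones start after it. *)
have B'P n x : (x <= n)%N -> B' (k n + x)%N <-> A x.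
  move=> xn; split=> [[m [a [Aa am]]]|Ax]; last first.
    by exists n, x; rewrite addnC.
  have [mn|nm|->] := ltngtP m n.
  - have := k_lt m n mn => lt_k e; exfalso.
    have : (a + k m < k n + x)%N.
      rewrite (leq_trans _ (leq_addr _ _))// (leq_trans _ lt_k)// ltnS addnC.
      by rewrite leq_add2l.
    by rewrite e ltnn.
  - have := k_lt n m nm => lt_k e; exfalso.
    have : (k n + x < a + k m)%N.
      rewrite (leq_trans _ (leq_addl _ _))// (leq_trans _ lt_k)// ltnS.
      by rewrite leq_add2l.
    by rewrite e ltnn.
  - by rewrite addnC => /addIn ->.
have [V [UV kV]] := ultraFilterLemma (fmap_proper_filter k eventually_filter).
have kV' (P : set nat) n : (forall m, (n <= m)%N -> P (k m)) -> V P.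
  by move=> nP; apply: kV; exists n.
exists V; split=> //; exists B'; split.
  by move=> _ [n [a [Aa an ->]]]; exact: kemb.
apply/seteqP; split=> x.
  by move=> Ax; apply: (kV' _ x) => m xm; exact/B'P.
(* Some j in [B' - x] also satisfies the implication that holds on the tail of [k] from x on. *)
move=> VB'; have VkB : V [set j | leftshift B' x j -> A x].
  by apply: (kV' _ x) => m xm /B'P; exact.
by have [j [Bj]] := filter_ex (filterI VB' VkB); exact.
Qed.

(** Shifting along the principal ultrafilter at [k] is subtracting [k], which undoes the translation
    in B' = A + k. *)
Let principal_shift k : (forall n, emb n k) ->
  exists V : set_system nat, UltraFilter V /\
    exists B', B' `<=` B /\ A = ultra_leftshift B' V.
Proof.
move=> embk; exists (principal_filter k); split.
  exact: principal_filter_ultra.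
exists (rightshift A k); split=> [_ [a Aa <-]|]; first exact: (embk a).
apply/seteqP; split=> x.
  by move=> Ax; apply/principal_filterP; exists x; rewrite // addnC.
by move/principal_filterP => [a Aa]; rewrite addnC => /addnI <-.
Qed.

Lemma finitely_embeddable_ultra_leftshift :
  finitely_embeddable A B ->
  exists V : set_system nat, UltraFilter V /\
    exists B', B' `<=` B /\ A = ultra_leftshift B' V.
Proof.
move=> /finitely_embeddableP AB.
have emb_ex n : exists k, emb n k.
  have [||k Bk] := AB (A `&` `I_n.+1).
  - by apply: finite_setIr; exact: finite_II.
  - by move=> a [].
  - by exists k => a Aa an; apply: Bk; split.
have embS n m k : (n <= m)%N -> emb m k -> emb n k.
  by move=> nm + a Aa an; apply => //; exact: leq_trans nm.
have [|/existsNP[n /existsNP[m nembB]]] :=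
  pselect (forall n m, exists2 k, (m <= k)%N & emb n k).
  exact: sparse_shift.
have [[k embk]|/forallNP nemb] := pselect (exists k, forall n, emb n k).
  exact: principal_shift embk.
have /choice[b bP] : forall k, exists l, ~ emb l k.
  by move=> k; apply/existsNP; exact: nemb.
(* This level is at least n, where no shift [>= m] survives, and at least every [b i], where the
   shift i < m has failed. So K is empty there. *)
have [k embk] := emb_ex (n + \sum_(i < m) b i)%N; exfalso.
have [mk|km] := leqP m k.
  by apply: nembB; exists k => //; apply: embS embk; exact: leq_addr.
apply: (bP k); apply: embS embk; rewrite (bigD1 (Ordinal km)) //= addnCA.
exact: leq_addr.
Qed.

End ShiftEquality.

(** * Hypernatural numbers as ultrafilters *)

Section Hypernatural.
Context {N : framework}.

Section StarSet.
Context {X : Type}.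
Implicit Types (A B : set X) (x : star N X).

Let fIn G A (y : var G X) : formula G :=
  @fRel G [:: X] [set t | A t.1] (y, tt).

Lemma star_setS A B : A `<=` B -> star_set N A `<=` star_set N B.
Proof.
move=> AB x Ax; apply: contrapT => nBx.
pose v := var_here [::] X.
(* Formulas have no implication, so the inclusion is transferred as: no y is in [A] and not in
   [B]. *)
have tr := (transfer N
  (fAll (fNot (fAnd (fIn _ A v) (fNot (fIn _ B v))))) tt).1.
by apply: (tr _ x) => // y [/AB].
Qed.

Lemma star_setI A B x :
  star_set N A x -> star_set N B x -> star_set N (A `&` B) x.
Proof.
move=> Ax Bx; apply: contrapT => nABx.
pose v := var_here [::] X.
have tr := (transfer N
  (fAll (fNot (fAnd (fAnd (fIn _ A v) (fIn _ B v)) (fNot (fIn _ (A `&` B) v)))))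
  tt).1.
by apply: (tr _ x) => // y [[? ?]]; apply.
Qed.

Lemma star_setC A x : star_set N (~` A) x <-> ~ star_set N A x.
Proof.
pose v := var_here [::] X.
have tr1 := (transfer N (fAll (fNot (fAnd (fIn _ A v) (fIn _ (~` A) v)))) tt).1.
have tr2 := (transfer N
  (fAll (fNot (fAnd (fNot (fIn _ A v)) (fNot (fIn _ (~` A) v))))) tt).1.
split=> [nAx Ax|nAx]; first by apply: (tr1 _ x) => // y [].
by apply: contrapT => nnAx; apply: (tr2 _ x) => // y [? /=]; apply.
Qed.

Definition hyper_ultra x : set_system X := [set A | star_set N A x].

Lemma hyper_ultraP x : UltraFilter (hyper_ultra x).
Proof.
have T_x : hyper_ultra x setT.
  have [//|/star_setC] := pselect (star_set N setT x); exact: star_setS.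
have PF : ProperFilter (hyper_ultra x).
  split; first by rewrite /hyper_ultra /= -setCT => /star_setC.
  by split=> // [A B|A B AB]; [exact: star_setI|exact: star_setS].
split=> // G PG xG; apply/seteqP; split=> // A GA.
apply: contrapT => /star_setC/xG GnA.
by have [y []] := filter_ex (filterI GA GnA).
Qed.

End StarSet.

(** Transfer, with the standard n as parameter, that y + n = w makes w in B equivalent to y in B -
    n. Hypernatural addition enters through its graph, and each direction has its own formula. *)
Lemma hyper_leftshiftE (B : set nat) (mu : star N nat) :
  hyper_leftshift B mu = ultra_leftshift B (hyper_ultra mu).
Proof.
suff shiftP n : star_set N B (star_fun addn mu (std N n)) <->
    star_set N (leftshift B n) mu.
  by apply/seteqP; split=> n /shiftP.
rewrite /star_fun; case: cid => z /= addz.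
pose G := [:: nat : Type; nat : Type; nat : Type].
pose vz : var G nat := var_here _ _.
pose vx : var G nat := var_next _ (var_here _ _).
pose vn : var G nat := var_next _ (var_next _ (var_here _ _)).
pose add : formula G :=
  @fRel G G [set t | (t.1 + t.2.1)%N = t.2.2.1]
    (vx, (vn, (vz, tt))).
pose inz : formula G := @fRel G [:: nat : Type] [set t | B t.1] (vz, tt).
pose inx : formula G :=
  @fRel G [:: nat : Type] [set t | leftshift B n t.1] (vx, tt).
have tr1 := (transfer N
  (fAll (fAll (fNot (fAnd add (fAnd inz (fNot inx)))))) (n, tt)).1.
have tr2 := (transfer N
  (fAll (fAll (fNot (fAnd add (fAnd (fNot inz) inx))))) (n, tt)).1.
split=> h; apply: contrapT => nh.
  by apply: (tr1 _ mu z); [move=> y w /= [<- []]|split].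
by apply: (tr2 _ mu z); [move=> y w /= [<- []]|split].
Qed.

(** Enlarging applies to [V] itself, a family of at most continuum many sets. A point in all their
    extensions has an ultrafilter containing [V], and [V] is maximal. *)
Lemma enlarging_hyper_ultra (V : set_system nat) :
  continuum_enlarging N -> UltraFilter V -> exists mu, hyper_ultra mu = V.
Proof.
move=> enl UV; have [||mu muV] := enl nat V.
- exact: card_leT.
- move=> D DV; apply: (@filter_ex _ V); apply: filter_bigI => X /DV.
  by rewrite inE.
- exists mu; apply: max_filter => [|X VX]; last exact: muV.
  by have [] := hyper_ultraP mu.
Qed.

End Hypernatural.

(** * The cycle of implications between the ten conditions *)

Theorem theoremA (N : framework) (N_enlarging : continuum_enlarging N)
    (A B : set nat) :
  [<-> finitely_embeddable A B;
       fip [set leftshift B a | a in A];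
       exists V : set_system nat, UltraFilter V /\ A `<=` ultra_leftshift B V;
       exists V : set_system nat, UltraFilter V /\
         exists B' : set nat, B' `<=` B /\ A = ultra_leftshift B' V;
       exists V : betaN,
         [set betaN_add U V | U in basic_open A] `<=` basic_open B;
       exists A' : set nat, A `<=` A' /\
         closure [set charfun (leftshift B k) | k in [set: nat]] (charfun A');
       exists B' : set nat, B' `<=` B /\
         closure [set charfun (leftshift B' k) | k in [set: nat]] (charfun A);
       exists mu : star N nat, A `<=` hyper_leftshift B mu;
       exists A' : set nat, A `<=` A' /\
         exists mu : star N nat, A' = hyper_leftshift B mu;
       exists B' : set nat, B' `<=` B /\
         exists mu : star N nat, A = hyper_leftshift B' mu].
Proof.
have ultra_emb (V : set_system nat) B' : UltraFilter V -> B' `<=` B ->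
    A `<=` ultra_leftshift B' V -> finitely_embeddable A B.
  move=> UV B'B AB'; apply: (@ultra_leftshift_finitely_embeddable A B V).
  by apply: subset_trans AB' _; exact: ultra_leftshiftS.
tfae.
- by move/fip_finitely_embeddable.
- move/fip_finitely_embeddable/finitely_embeddable_ultra_leftshift.
  move=> [V [UV [B' [B'B ->]]]]; exists V; split=> //.
  exact: ultra_leftshiftS.
- move=> [V [UV AB]]; apply: finitely_embeddable_ultra_leftshift.
  exact: ultra_emb AB.
- move=> [V [UV [B' [B'B AE]]]]; exists (BetaN UV) => _ [U AU <-] /=.
  have FU := ultra_ultrafilter U; apply: filterS AU => a; rewrite AE.
  exact: ultra_leftshiftS.
- move=> [V AB]; exists (ultra_leftshift B (ultra V)); split; last first.
    exact/closure_ultra_leftshift/ultra_ultrafilter.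
  (* The inclusion is tested on the principal ultrafilter at a: its sum with [V] contains [B]
     exactly when [B - a] is in [V]. *)
  move=> a Aa; have /AB : [set betaN_add U V | U in basic_open A]
      (betaN_add (BetaN (principal_filter_ultra a)) V).
    by exists (BetaN (principal_filter_ultra a)) => //; exact/principal_filterP.
  by move/principal_filterP.
- move=> [A' [AA' /closure_finitely_embeddable A'B]].
  have [|V [UV [B' [B'B ->]]]] :=
    @finitely_embeddable_ultra_leftshift A B.
    by move=> F finF FA; apply: A'B => //; exact: subset_trans AA'.
  by exists B'; split=> //; exact: closure_ultra_leftshift.
- move=> [B' [B'B /closure_finitely_embeddable]].
  move/finitely_embeddable_ultra_leftshift => [V [UV [C [CB' ->]]]].
  have [mu muV] := enlarging_hyper_ultra V N_enlarging UV.
  exists mu; rewrite hyper_leftshiftE muV.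
  by apply: ultra_leftshiftS; exact: subset_trans B'B.
- by move=> [mu AB]; exists (hyper_leftshift B mu); split=> //; exists mu.
- move=> [A' [+ [mu A'E]]]; rewrite {}A'E => AB; have U_mu := hyper_ultraP mu.
  (* [A] may be smaller than [B_mu]; getting [A] exactly takes a new ultrafilter and [B'], hence a
     new hypernatural [nu]. *)
  have [|V [UV [B' [B'B ->]]]] :=
    @finitely_embeddable_ultra_leftshift A B.
    by apply: (ultra_emb (hyper_ultra mu) B); rewrite // -hyper_leftshiftE.
  exists B'; split=> //.
  have [nu nuV] := enlarging_hyper_ultra V N_enlarging UV.
  by exists nu; rewrite hyper_leftshiftE nuV.
- move=> [B' [B'B [mu AE]]]; have U_mu := hyper_ultraP mu.
  by apply: (ultra_emb (hyper_ultra mu) B'); rewrite // AE hyper_leftshiftE.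
Qed.
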